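(* Let $\theta>0$, $m,p\in\mathbb N$, $\beta_0\in(-1,0]$ and $\beta=\beta_0+p$. For every $\xi\in\mathbb C^*=\mathbb C\setminus\{0\}$, $$\lim_{R\to+\infty}\mathcal K_{\theta R^2,\beta}^{m,R}(\xi)=\mathcal L_{\theta,\beta}^m(\xi).$$
   Context: $\mathbb N=\{0,1,2,\dots\}$. $(a)_n=a(a+1)\cdots(a+n-1)$ is the Pochhammer symbol, and ${}_kF_j\left(\left.\begin{array}{c}a_1,\dots,a_k\\ b_1,\dots,b_j\end{array}\right|\xi\right)=\sum_{n=0}^{\infty}\frac{(a_1)_n\cdots(a_k)_n}{(b_1)_n\cdots(b_j)_n}\frac{\xi^n}{n!}$. For $R>0$, $\alpha>-1$, $\beta=\beta_0+p$ and $0<|\xi|<R^2$, $$\mathcal K_{\alpha,\beta}^{m,R}(\xi)=\sum_{n=0}^{m-1}\frac{(\alpha+\beta+2)_n}{(\beta+1)_n}\left(\frac{\xi}{R^2}\right)^n+\frac{\xi^m}{(m!)^2}\ {}_4F_3\left(\left.\begin{array}{c}1,1,1,\alpha+\beta+2\\ m+1,m+1,\beta+1\end{array}\right|\frac{\xi}{R^2}\right)+A_{\alpha,\beta}^{m,R}(\xi),$$ where $A_{\alpha,\beta}^{m,R}(\xi)=0$ if $p\le m$, and if $p>m$ $$A_{\alpha,\beta}^{m,R}(\xi)=R^{2m}\sum_{k=0}^{p-m-1}\frac{\Gamma(\alpha+\beta+1-m-k)}{\Gamma(\beta-m-k)}\frac{\Gamma(\beta+1)}{\Gamma(\alpha+\beta+2)}\left(\frac{k!}{(m+k)!}\right)^2\left(\frac{R^2}{\xi}\right)^{k+1}.$$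 (In the limit, $\alpha=\theta R^2$ and $R$ is large enough that $|\xi|<R^2$.) For $\xi\in\mathbb C^*$, $$\mathcal L_{\theta,\beta}^m(\xi)=\sum_{n=0}^{m-1}\frac{(\theta\xi)^n}{(\beta+1)_n}+\frac{\xi^m}{(m!)^2}\ {}_3F_3\left(\left.\begin{array}{c}1,1,1\\ m+1,m+1,\beta+1\end{array}\right|\theta\xi\right)+B_{\theta,\beta}^m(\xi),$$ where $B_{\theta,\beta}^m(\xi)=0$ if $p\le m$ and $B_{\theta,\beta}^m(\xi)=\frac1{\theta^m}\sum_{k=0}^{p-m-1}\left(\frac{k!}{(m+k)!}\right)^2\frac{\Gamma(\beta+1)}{\Gamma(\beta-m-k)}\frac1{(\theta\xi)^{k+1}}$ if $p>m$. (These are the functions giving, via $\xi=z\overline w$, the reproducing kernels of the modified Bergman-Dirichlet space $\mathcal D^2_m(\mathbb D_R,\mu^R_{\alpha,\beta})$ and of the modified Bargmann-Dirichlet space $\mathcal B^2_m(\mathbb C,\nu_{\theta,\beta})$.) *)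

(* Defs.v *)
From Stdlib Require Import Reals List Arith.
From Coquelicot Require Import Coquelicot.
Import ListNotations.

Open Scope R_scope.

(* Euler's integral of the second kind; it converges, hence is meaningful,
   exactly for x > 0, and every use below has a positive argument. *)
Definition Gamma (x : R) : R :=
  RInt_gen (fun t => Rpower t (x - 1) * exp (- t)) (at_right 0) (Rbar_locally p_infty).

Fixpoint poch (a : R) (n : nat) : R :=
  match n with
  | O => 1
  | S k => poch a k * (a + INR k)
  end.

(* [Csum f n] has the n terms f 0, ..., f (n-1), whereas [sum_n f n] has n+1. *)
Definition Csum (f : nat -> C) (n : nat) : C :=
  match n with
  | O => RtoC 0
  | S k => sum_n f k
  end.

(* Sum of a complex series (unspecified if it diverges), Coquelicot's [Series]
   being real-valued. *)
Definition CSeries (f : nat -> C) : C :=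
  @iota C_CompleteNormedModule (@is_series C_AbsRing C_NormedModule f).

Definition poch_prod (l : list R) (n : nat) : R :=
  fold_right Rmult 1 (map (fun a => poch a n) l).

Definition hypergeometric (a b : list R) (xi : C) : C :=
  CSeries (fun n =>
    (RtoC (poch_prod a n / poch_prod b n) * (xi ^ n / RtoC (INR (fact n))))%C).

Definition A_term (alpha beta : R) (p m : nat) (r : R) (xi : C) : C :=
  if (p <=? m)%nat then RtoC 0
  else
    (RtoC (r ^ (2 * m)) *
     Csum (fun k =>
       RtoC (Gamma (alpha + beta + 1 - INR m - INR k) / Gamma (beta - INR m - INR k)
             * (Gamma (beta + 1) / Gamma (alpha + beta + 2))
             * (INR (fact k) / INR (fact (m + k))) ^ 2)
       * (RtoC (r ^ 2) / xi) ^ (k + 1)) (p - m))%C.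

(* r is the radius of the disc; p is the integer with beta - p in (-1,0].
   Meaningful for r > 0, alpha > -1 and 0 < |xi| < r^2. *)
Definition K_bergman (alpha beta : R) (p m : nat) (r : R) (xi : C) : C :=
  (Csum (fun n =>
     RtoC (poch (alpha + beta + 2) n / poch (beta + 1) n) * (xi / RtoC (r ^ 2)) ^ n) m
   + xi ^ m / RtoC (INR (fact m) ^ 2)
     * hypergeometric [1%R; 1%R; 1%R; (alpha + beta + 2)%R]
                      [(INR m + 1)%R; (INR m + 1)%R; (beta + 1)%R]
                      (xi / RtoC (r ^ 2))
   + A_term alpha beta p m r xi)%C.

Definition B_term (theta beta : R) (p m : nat) (xi : C) : C :=
  if (p <=? m)%nat then RtoC 0
  else
    (RtoC (1 / theta ^ m) *
     Csum (fun k =>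
       RtoC ((INR (fact k) / INR (fact (m + k))) ^ 2
             * (Gamma (beta + 1) / Gamma (beta - INR m - INR k)))
       * (1 / (RtoC theta * xi) ^ (k + 1))) (p - m))%C.

Definition L_bargmann (theta beta : R) (p m : nat) (xi : C) : C :=
  (Csum (fun n => (RtoC theta * xi) ^ n / RtoC (poch (beta + 1) n)) m
   + xi ^ m / RtoC (INR (fact m) ^ 2)
     * hypergeometric [1%R; 1%R; 1%R]
                      [(INR m + 1)%R; (INR m + 1)%R; (beta + 1)%R]
                      (RtoC theta * xi)
   + B_term theta beta p m xi)%C.

(* Main.v *)
Require Import Defs.
From Stdlib Require Import Reals Arith FunctionalExtensionality Lra Lia List.
From Coquelicot Require Import Coquelicot.

(** Write [a = theta r^2 + beta]. Every dependence of the kernel on [r] goes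
    through quotients [(a + c')_n / r^(2n)] of a Pochhammer symbol by the
    power of [r^2] that balances it. Such a quotient is the product over
    [j < n] of [theta + (c + j) / r^2], hence tends to [theta^n]
    ([is_lim_scaled_poch]), and for [c > 0] it decreases in [r]
    ([scaled_poch_antitone]).

    - In the polynomial part each of the [m] terms converges for this reason.
    - In the hypergeometric series the terms also converge one by one. By
      monotonicity they are dominated, for all [r >= r0], by the terms at
      [r0]. The ratio test shows that these are summable as soon as
      [|xi| < r0^2]: although the limit series has infinite radius of
      convergence, the dominating one only has radius [r0^2], and [r0] is
      chosen after [xi]. Tannery's theorem ([filterlim_CSeries_dominated])
      then exchanges limit and sum.
    - In the third part, the functional equation of the Gamma function turns
      [Gamma (a + 1 - m - k) / Gamma (a + 2)] into the inverse of a Pochhammer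
      symbol of length [m + k + 1], which is exactly the length balanced by the
      available powers of [r^2]. The quotient [Gamma (beta + 1) / Gamma (beta - m - k)]
      is a constant common to both sides, so Gamma matters only at large
      arguments. There [Gamma x] with [x > 1] is enough, and the convergence of
      Euler's integral and its functional equation are proved in that range. *)

Open Scope R_scope.

(** * The Gamma function at arguments greater than 1 *)

(** The integrals over [[a, b]] increase with the interval and are bounded, so
    they converge to their supremum. *)
Lemma is_RInt_gen_pos_bounded (f : R -> R) (M : R) :
  (forall t, 0 < t -> continuous f t) ->
  (forall t, 0 < t -> 0 < f t) ->
  (forall a b, 0 < a < b -> RInt f a b <= M) ->
  exists l, 0 < l /\ is_RInt_gen f (at_right 0) (Rbar_locally p_infty) l.
Proof.
  intros Hc Hp HM.
  assert (Hex : forall a b, 0 < a -> a <= b -> ex_RInt f a b).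
  { intros a b Ha Hab; apply (ex_RInt_continuous (V := R_CompleteNormedModule)); intros t Ht.
    rewrite Rmin_left in Ht by lra; apply Hc; lra. }
  assert (Hmono : forall a b a' b', 0 < a' <= a -> a <= b -> b <= b' ->
            RInt f a b <= RInt f a' b').
  { intros a b a' b' Ha Hab Hb.
    assert (E1 := RInt_Chasles f a' a b' (Hex a' a ltac:(lra) ltac:(lra))
                    (Hex a b' ltac:(lra) ltac:(lra))).
    assert (E2 := RInt_Chasles f a b b' (Hex a b ltac:(lra) ltac:(lra))
                    (Hex b b' ltac:(lra) ltac:(lra))).
    assert (P1 : 0 <= RInt f a' a).
    { apply RInt_ge_0; [lra| apply Hex; lra|].
      intros t Ht; apply Rlt_le, Hp; lra. }
    assert (P2 : 0 <= RInt f b b').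
    { apply RInt_ge_0; [lra| apply Hex; lra|].
      intros t Ht; apply Rlt_le, Hp; lra. }
    change (RInt f a' a + RInt f a b' = RInt f a' b') in E1.
    change (RInt f a b + RInt f b b' = RInt f a b') in E2. lra. }
  destruct (completeness (fun y => exists a b, 0 < a < b /\ y = RInt f a b))
    as [l [Hub Hlub]].
  - exists M; intros y (a & b & Hab & ->); now apply HM.
  - exists (RInt f 1 2), 1, 2; split; [lra | reflexivity].
  - assert (H12 : 0 < RInt f 1 2).
    { apply RInt_gt_0; [lra| intros; apply Hp; lra | intros; apply Hc; lra]. }
    exists l; split.
    + apply Rlt_le_trans with (1 := H12), Hub.
      exists 1, 2; split; [lra | reflexivity].
    + intros P [eps HP].
      assert (Hn : exists a b, 0 < a < b /\ l - eps < RInt f a b).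
      { apply Classical_Prop.NNPP; intros Hno.
        assert (l <= l - eps).
        { apply Hlub; intros y (a & b & Hab & ->).
          destruct (Rle_or_lt (RInt f a b) (l - eps)) as [|Hlt]; [assumption|].
          exfalso; apply Hno; exists a, b; tauto. }
        destruct eps as [e He]; simpl in *; lra. }
      destruct Hn as (a0 & b0 & Hab & Hlt).
      apply Filter_prod with (fun a => 0 < a < a0) (fun b => b0 < b).
      * exists (mkposreal a0 (proj1 Hab)); intros a Ha Ha0.
        change (Rabs (a - 0) < a0) in Ha; apply Rabs_def2 in Ha; lra.
      * now exists b0.
      * intros a b Ha Hb; exists (RInt f a b); split.
        -- apply (RInt_correct f), Hex; lra.
        -- apply HP; change (Rabs (RInt f a b - l) < eps).
           assert (RInt f a b <= l).
           { apply Hub; exists a, b; split; [lra | reflexivity]. }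
           assert (RInt f a0 b0 <= RInt f a b) by (apply Hmono; lra).
           apply Rabs_def1; destruct eps as [e He]; simpl in *; lra.
Qed.

Lemma RInt_gen_half_line_unique (f : R -> R) (l : R) :
  is_RInt_gen f (at_right 0) (Rbar_locally p_infty) l ->
  RInt_gen f (at_right 0) (Rbar_locally p_infty) = l.
Proof.
  apply (@is_RInt_gen_unique R_CompleteNormedModule (at_right 0) (Rbar_locally p_infty)
           (Proper_StrongProper _ (at_right_proper_filter 0))
           (Proper_StrongProper _ (Rbar_locally_filter p_infty))).
Qed.

(** The constant comes from [ln u <= u - 1] at [u = t / (2 s)], the scale at which
    [s u] is exactly [t / 2]. *)
Lemma Rpower_le_exp_half (s : R) : 0 < s ->
  exists K, 0 < K /\ forall t, 0 < t -> Rpower t s <= K * exp (t / 2).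
Proof.
  intros Hs; exists (exp (s * (ln (2 * s) - 1))); split; [apply exp_pos|].
  intros t Ht; unfold Rpower; rewrite <- exp_plus.
  apply Rnot_lt_le; intros Hlt; apply exp_lt_inv in Hlt.
  assert (H : ln (t / (2 * s)) <= t / (2 * s) - 1).
  { assert (Hq : 0 < t / (2 * s)) by (apply Rdiv_lt_0_compat; lra).
    assert (E := exp_ineq1_le (ln (t / (2 * s)))).
    rewrite exp_ln in E by assumption; lra. }
  rewrite ln_div in H by lra.
  apply Rmult_le_compat_l with (r := s) in H; [|lra].
  replace (s * (t / (2 * s) - 1)) with (t / 2 - s) in H by (field; lra).
  lra.
Qed.

Lemma continuous_Gamma_integrand (s t : R) : 0 < t ->
  continuous (fun t => Rpower t s * exp (- t)) t.
Proof.
  intros Ht; apply (ex_derive_continuous (V := R_NormedModule)).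
  unfold Rpower; auto_derive; exact Ht.
Qed.

(** The integrand is dominated by a multiple of [exp (- t / 2)] on the whole half
    line, because its power of [t] has positive exponent. *)
Lemma is_RInt_gen_Gamma (x : R) : 1 < x ->
  0 < Gamma x /\
  is_RInt_gen (fun t => Rpower t (x - 1) * exp (- t))
    (at_right 0) (Rbar_locally p_infty) (Gamma x).
Proof.
  intros Hx.
  destruct (Rpower_le_exp_half (x - 1)) as (K & HK & HKt); [lra|].
  destruct (is_RInt_gen_pos_bounded
              (fun t => Rpower t (x - 1) * exp (- t)) (2 * K)) as (l & Hl & Hint).
  - intros; now apply continuous_Gamma_integrand.
  - intros; apply Rmult_lt_0_compat; apply exp_pos.
  - intros a b Hab.
    assert (I : is_RInt (fun t => K * exp (- t / 2)) a b
                  (minus (- 2 * K * exp (- b / 2)) (- 2 * K * exp (- a / 2)))).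
    { apply (is_RInt_derive (V := R_CompleteNormedModule) (fun t => - 2 * K * exp (- t / 2))).
      - intros t _; auto_derive; [easy | unfold Rdiv; field].
      - intros t _; apply (ex_derive_continuous (V := R_NormedModule)).
        auto_derive; easy. }
    apply Rle_trans with (minus (- 2 * K * exp (- b / 2)) (- 2 * K * exp (- a / 2))).
    + rewrite <- (is_RInt_unique _ _ _ _ I).
      apply RInt_le; [lra | | eexists; exact I |].
      * apply (ex_RInt_continuous (V := R_CompleteNormedModule)); intros t Ht.
        rewrite Rmin_left in Ht by lra; apply continuous_Gamma_integrand; lra.
      * intros t Ht.
        replace (K * exp (- t / 2)) with (K * exp (t / 2) * exp (- t)).
        -- apply Rmult_le_compat_r; [apply Rlt_le, exp_pos | apply HKt; lra].
        -- rewrite Rmult_assoc, <- exp_plus; do 2 f_equal; field.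
    + change (- 2 * K * exp (- b / 2) - - 2 * K * exp (- a / 2) <= 2 * K).
      assert (0 < exp (- b / 2)) by apply exp_pos.
      assert (exp (- a / 2) < 1) by (rewrite <- exp_0; apply exp_increasing; lra).
      nra.
  - assert (E : Gamma x = l) by exact (RInt_gen_half_line_unique _ l Hint).
    rewrite E; now split.
Qed.

Lemma filterlim_Rpower_mul_exp_at_0 (x : R) : 0 < x ->
  filterlim (fun t => Rpower t x * exp (- t)) (at_right 0) (locally 0).
Proof.
  intros Hx; apply filterlim_locally; intros [e He].
  exists (mkposreal _ (exp_pos (ln e / x))); intros t Ht Ht0.
  change (Rabs (t - 0) < exp (ln e / x)) in Ht.
  change (Rabs (Rpower t x * exp (- t) - 0) < e).
  rewrite Rminus_0_r in *; rewrite Rabs_pos_eq in Ht by lra.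
  assert (exp (- t) < 1) by (rewrite <- exp_0; apply exp_increasing; lra).
  assert (0 < exp (- t)) by apply exp_pos.
  assert (0 < Rpower t x) by apply exp_pos.
  assert (Rpower t x < e).
  { apply Rlt_le_trans with (Rpower (exp (ln e / x)) x).
    - apply Rlt_Rpower_l; lra.
    - unfold Rpower; rewrite ln_exp; right.
      replace (x * (ln e / x)) with (ln e) by (field; lra); now apply exp_ln. }
  rewrite Rabs_pos_eq; nra.
Qed.

Lemma filterlim_Rpower_mul_exp_at_infty (x : R) : 0 < x ->
  filterlim (fun t => Rpower t x * exp (- t)) (Rbar_locally p_infty) (locally 0).
Proof.
  intros Hx; destruct (Rpower_le_exp_half x Hx) as (K & HK & HKt).
  apply filterlim_locally; intros [e He].
  exists (Rmax 0 (- 2 * ln (e / K))); intros t Ht.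
  assert (Ht0 := Rle_lt_trans _ _ _ (Rmax_l _ _) Ht).
  assert (Ht1 := Rle_lt_trans _ _ _ (Rmax_r _ _) Ht).
  change (Rabs (Rpower t x * exp (- t) - 0) < e); rewrite Rminus_0_r.
  assert (0 < exp (- t)) by apply exp_pos.
  assert (0 < Rpower t x) by apply exp_pos.
  rewrite Rabs_pos_eq by nra.
  apply Rle_lt_trans with (K * exp (t / 2) * exp (- t)).
  - apply Rmult_le_compat_r; [lra | now apply HKt].
  - rewrite Rmult_assoc, <- exp_plus.
    apply Rlt_le_trans with (K * (e / K)); [| right; field; lra].
    apply Rmult_lt_compat_l; [assumption|].
    rewrite <- (exp_ln (e / K)) by (apply Rdiv_lt_0_compat; lra).
    apply exp_increasing; lra.
Qed.

(** Integration by parts: [t^x exp (-t)] vanishes at both ends and its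
    derivative is [x t^(x-1) exp (-t) - t^x exp (-t)]. *)
Lemma Gamma_succ (x : R) : 1 < x -> Gamma (x + 1) = x * Gamma x.
Proof.
  intros Hx.
  destruct (is_RInt_gen_Gamma x Hx) as [_ I0].
  destruct (is_RInt_gen_Gamma (x + 1)) as [_ I1]; [lra|].
  set (G := fun t => Rpower t x * exp (- t)).
  set (f0 := fun t => Rpower t (x - 1) * exp (- t)) in I0.
  assert (HG : forall t, 0 < t -> is_derive G t (x * f0 t - G t)).
  { intros t Ht; unfold G, f0, Rpower; auto_derive; [exact Ht|].
    replace (exp ((x - 1) * ln t)) with (exp (x * ln t) / t); [field; lra|].
    replace ((x - 1) * ln t) with (x * ln t + - ln t) by ring.
    rewrite exp_plus, exp_Ropp, exp_ln by assumption; reflexivity. }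
  (* On the product filter both bounds of integration are positive. *)
  assert (Hpos : forall P : R -> Prop, (forall t, 0 < t -> P t) ->
    filter_prod (at_right 0) (Rbar_locally p_infty)
      (fun ab => forall t, Rmin (fst ab) (snd ab) <= t <= Rmax (fst ab) (snd ab) -> P t)).
  { intros P HP; apply Filter_prod with (fun a => 0 < a) (fun b => 0 < b).
    - exists (mkposreal 1 Rlt_0_1); intros a _ Ha; exact Ha.
    - now exists 0.
    - intros a b Ha Hb t Ht; apply HP; simpl in Ht.
      apply Rlt_le_trans with (2 := proj1 Ht); now apply Rmin_glb_lt. }
  assert (ID : is_RInt_gen (Derive G) (at_right 0) (Rbar_locally p_infty) (0 - 0)).
  { apply is_RInt_gen_Derive; try (apply Hpos; intros t Ht).
    - eexists; now apply HG.
    - apply continuous_ext_loc with (fun t => x * f0 t - G t).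
      + exists (mkposreal t Ht); intros y Hy.
        change (Rabs (y - t) < t) in Hy; apply Rabs_def2 in Hy.
        symmetry; apply is_derive_unique, HG; lra.
      + apply (continuous_minus (V := R_NormedModule)).
        * apply (continuous_scal_r (V := R_NormedModule)).
          now apply continuous_Gamma_integrand.
        * now apply continuous_Gamma_integrand.
    - apply filterlim_Rpower_mul_exp_at_0; lra.
    - apply filterlim_Rpower_mul_exp_at_infty; lra. }
  assert (IS := is_RInt_gen_minus _ _ _ _ (is_RInt_gen_scal _ x _ I0) ID).
  apply is_RInt_gen_ext with (g := fun t => Rpower t (x + 1 - 1) * exp (- t)) in IS.
  - apply RInt_gen_half_line_unique in IS.
    unfold Gamma at 1; etransitivity; [exact IS|].
    change (x * Gamma x - (0 - 0) = x * Gamma x); ring.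
  - assert (W := Hpos (fun t => x * f0 t - Derive G t = Rpower t (x + 1 - 1) * exp (- t))).
    eapply filter_imp; [| apply W].
    + intros ab H t Ht; apply H; lra.
    + intros t Ht; rewrite (is_derive_unique _ _ _ (HG t Ht)).
      replace (x + 1 - 1) with x by ring; unfold G; ring.
Qed.

Lemma Gamma_add_nat (x : R) (n : nat) : 1 < x ->
  Gamma (x + INR n) = poch x n * Gamma x.
Proof.
  intros Hx; induction n as [|n IH].
  - simpl; rewrite Rplus_0_r; ring.
  - rewrite S_INR, <- Rplus_assoc, Gamma_succ, IH.
    + simpl; ring.
    + assert (H := pos_INR n); lra.
Qed.

(** * Pochhammer symbols with a large parameter *)

Lemma poch_pos (a : R) (n : nat) : 0 < a -> 0 < poch a n.
Proof.
  intros Ha; induction n as [|n IH]; simpl; [lra|].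
  apply Rmult_lt_0_compat; [exact IH | assert (H := pos_INR n); lra].
Qed.

Lemma poch_le (a b : R) (n : nat) : 0 < a <= b -> poch a n <= poch b n.
Proof.
  intros Hab; induction n as [|n IH]; simpl; [lra|].
  assert (H := pos_INR n); assert (Hp := poch_pos a n (proj1 Hab)).
  apply Rmult_le_compat; lra.
Qed.

Lemma poch_1 (n : nat) : poch 1 n = INR (fact n).
Proof.
  induction n as [|n IH]; [reflexivity|].
  change (fact (S n)) with (S n * fact n)%nat.
  rewrite mult_INR, S_INR, <- IH; simpl; ring.
Qed.

Definition scaled_poch (theta c : R) (n : nat) (r : R) : R :=
  poch (theta * r ^ 2 + c) n / (r ^ 2) ^ n.

(** The factor gained at each step shows the behaviour in [r]: it tends to
    [theta], and does so decreasingly when [c + n] is positive. *)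
Lemma scaled_poch_succ (theta c : R) (n : nat) (r : R) : r <> 0 ->
  scaled_poch theta c (S n) r =
  scaled_poch theta c n r * (theta + (c + INR n) * / (r ^ 2)).
Proof.
  intros Hr; unfold scaled_poch; simpl; field.
  split; [assumption | apply pow_nonzero; nra].
Qed.

Lemma scaled_poch_pos (theta c : R) (n : nat) (r : R) :
  0 < theta -> 0 < c -> 0 < r -> 0 < scaled_poch theta c n r.
Proof.
  intros; assert (0 < r ^ 2) by now apply pow_lt.
  apply Rdiv_lt_0_compat; [apply poch_pos; nra | now apply pow_lt].
Qed.

Lemma is_lim_scaled_poch (theta c : R) (n : nat) :
  is_lim (scaled_poch theta c n) p_infty (theta ^ n).
Proof.
  induction n as [|n IH].
  - apply is_lim_ext with (fun _ => 1); [|apply is_lim_const].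
    intros r; unfold scaled_poch; simpl; field.
  - apply is_lim_ext_loc with
      (fun r => scaled_poch theta c n r * (theta + (c + INR n) * (/ r * / r))).
    { exists 0; intros r Hr; rewrite scaled_poch_succ by lra.
      f_equal; f_equal; f_equal; field; lra. }
    assert (Hinv : is_lim Rinv p_infty 0).
    { apply (is_lim_inv (fun r => r) p_infty p_infty); [apply is_lim_id | easy]. }
    replace (theta ^ S n) with (theta ^ n * (theta + (c + INR n) * (0 * 0))) by (simpl; ring).
    apply (is_lim_mult _ _ _ (theta ^ n) (theta + (c + INR n) * (0 * 0)));
      [exact IH | | easy].
    apply is_lim_plus'; [apply is_lim_const|].
    apply (is_lim_scal_l _ _ _ (0 * 0)).
    now apply (is_lim_mult _ _ _ 0 0).
Qed.

Lemma scaled_poch_antitone (theta c : R) (n : nat) (r0 r : R) :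
  0 < theta -> 0 < c -> 0 < r0 <= r ->
  scaled_poch theta c n r <= scaled_poch theta c n r0.
Proof.
  intros Ht Hc Hr; induction n as [|n IH].
  - unfold scaled_poch; simpl; lra.
  - rewrite !scaled_poch_succ by lra.
    assert (Hn := pos_INR n).
    assert (0 < r ^ 2) by (apply pow_lt; lra).
    assert (0 < / r ^ 2) by now apply Rinv_0_lt_compat.
    assert (/ r ^ 2 <= / r0 ^ 2).
    { apply Rinv_le_contravar; [apply pow_lt; lra | apply pow_incr; lra]. }
    apply Rmult_le_compat; [| nra | exact IH | nra].
    apply Rlt_le, scaled_poch_pos; lra.
Qed.

(** Ratio test: consecutive terms have quotient
    [x (theta + (c + n) / r^2) / (b + n)], with limit [x / r^2 < 1]. *)
Lemma ex_series_scaled_poch_ratio (theta c b r x : R) :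
  0 < theta -> 0 < c -> 0 < b -> 0 < r -> 0 < x < r ^ 2 ->
  ex_series (fun n => scaled_poch theta c n r / poch b n * x ^ n).
Proof.
  intros Ht Hc Hb Hr Hx.
  assert (Hpos : forall n, 0 < scaled_poch theta c n r / poch b n * x ^ n).
  { intros n; apply Rmult_lt_0_compat; [| apply pow_lt; lra].
    apply Rdiv_lt_0_compat; [now apply scaled_poch_pos | now apply poch_pos]. }
  apply ex_series_ext with (fun n => Rabs (scaled_poch theta c n r / poch b n * x ^ n)).
  { intros n; apply Rabs_pos_eq, Rlt_le, Hpos. }
  apply ex_series_DAlembert with (x / r ^ 2).
  - apply Rmult_lt_reg_r with (r ^ 2); [lra|]; unfold Rdiv.
    rewrite Rmult_assoc, Rinv_l; lra.
  - intros n; apply Rgt_not_eq, Hpos.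
  - (* [theta + (c + n) / r^2] is split as [(b + n) / r^2] plus a constant. *)
    set (d := x * (theta + (c - b) / r ^ 2)).
    apply is_lim_seq_ext with (fun n => d * / (b + INR n) + x / r ^ 2).
    + intros n; assert (Hn := pos_INR n).
      rewrite Rabs_pos_eq by (apply Rlt_le, Rdiv_lt_0_compat; apply Hpos).
      rewrite scaled_poch_succ by lra.
      assert (Hs := scaled_poch_pos theta c n r Ht Hc Hr).
      assert (Hp := poch_pos b n Hb).
      assert (Hxn : 0 < x ^ n) by (apply pow_lt; lra).
      unfold d; simpl poch; simpl pow; field; repeat split; lra.
    + replace (Finite (x / r ^ 2)) with (Finite (d * 0 + x / r ^ 2)) by (f_equal; ring).
      apply is_lim_seq_plus'; [| apply is_lim_seq_const].
      apply (is_lim_seq_scal_l _ d 0).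
      apply (is_lim_seq_inv _ p_infty); [| easy].
      apply (is_lim_seq_plus _ _ b p_infty); [apply is_lim_seq_const | apply is_lim_seq_INR | easy].
Qed.

(** * Limits of complex sums and series *)

Lemma CSeries_unique (a : nat -> C) (l : C) :
  @is_series C_AbsRing C_NormedModule a l -> CSeries a = l.
Proof.
  intros Ha; exact (iota_filterlim_locally (V := C_CompleteNormedModule) (sum_n a) l Ha).
Qed.

Lemma CSeries_tail_le (a : nat -> C) (M : nat -> R) (n : nat) :
  ex_series M -> (forall k, Cmod (a k) <= M k) ->
  Cmod (minus (sum_n a n) (CSeries a)) <= Series M - sum_n M n.
Proof.
  intros HM Ha.
  destruct (ex_series_le (V := C_CompleteNormedModule) a M Ha HM) as [l Hl].
  rewrite (CSeries_unique a l Hl).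
  apply le_epsilon; intros e He.
  destruct (proj1 (filterlim_locally_ball_norm (U := C_NormedModule) (sum_n a) l)
              Hl (mkposreal e He)) as [N HN].
  set (k := max n N).
  assert (Hk : Cmod (minus (sum_n a k) l) < e) by (apply HN; lia).
  assert (Hd : Cmod (minus (sum_n a k) (sum_n a n)) <= sum_n M k - sum_n M n).
  { assert (E : sum_n_m a (S n) k = minus (sum_n a k) (sum_n a n))
      by (apply (sum_n_m_sum_n (G := C_NormedModule)); lia).
    rewrite <- E.
    assert (EM : sum_n_m M (S n) k = sum_n M k - sum_n M n)
      by (apply (sum_n_m_sum_n (G := R_NormedModule)); lia).
    rewrite <- EM; eapply Rle_trans; [apply (norm_sum_n_m (V := C_NormedModule))|].
    apply sum_n_m_le; exact Ha. }
  assert (HS : sum_n M k <= Series M).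
  { apply is_lim_seq_incr_compare; [exact (Series_correct M HM)|].
    intros i; rewrite sum_Sn; change (sum_n M i <= sum_n M i + M (S i)).
    assert (H := Cmod_ge_0 (a (S i))); specialize (Ha (S i)); lra. }
  replace (minus (sum_n a n) l)
    with (Cplus (minus (sum_n a k) l) (Copp (minus (sum_n a k) (sum_n a n)))).
  - eapply Rle_trans; [apply Cmod_triangle|]; rewrite Cmod_opp; lra.
  - unfold minus, plus, opp; simpl; ring.
Qed.

(** Tannery's theorem. The domination makes the partial sums converge uniformly
    in [t], so the limits in [n] and in [t] may be exchanged. *)
Lemma filterlim_CSeries_dominated {T : Type} {F : (T -> Prop) -> Prop}
  {FF : ProperFilter F} (f : T -> nat -> C) (g : nat -> C) (M : nat -> R) :
  ex_series M ->
  (forall t n, Cmod (f t n) <= M n) ->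
  (forall n, filterlim (fun t => f t n) F (locally (T := C_UniformSpace) (g n))) ->
  filterlim (fun t => CSeries (f t)) F (locally (T := C_UniformSpace) (CSeries g)).
Proof.
  intros HM Hf Hg.
  destruct (filterlim_switch (U := C_CompleteNormedModule) eventually _ F _
              (fun n t => sum_n (f t) n) (fun t => CSeries (f t)) (sum_n g))
    as (l & Hl & Hlim).
  - apply (filterlim_locally (U := fct_UniformSpace T C_UniformSpace)); intros eps.
    destruct (proj1 (filterlim_locally (F := eventually) (sum_n M) (Series M))
                (Series_correct M HM) eps) as [N HN].
    exists N; intros n Hn t; apply C_NormedModule_mixin_compat1.
    eapply Rle_lt_trans; [exact (CSeries_tail_le (f t) M n HM (Hf t))|].
    specialize (HN n Hn); change (Rabs (sum_n M n - Series M) < eps) in HN.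
    apply Rabs_def2 in HN; lra.
  - intros n; induction n as [|n IH].
    + apply filterlim_ext with (fun t => f t O); [intros t; now rewrite sum_O|].
      rewrite sum_O; apply Hg.
    + apply filterlim_ext with (fun t => plus (sum_n (f t) n) (f t (S n))).
      { intros t; now rewrite sum_Sn. }
      rewrite sum_Sn; eapply filterlim_comp_2; [exact IH | apply Hg|].
      apply (filterlim_plus (V := C_NormedModule)).
  - rewrite (CSeries_unique g l Hl); exact Hlim.
Qed.

Lemma filterlim_Cplus {T : Type} {F : (T -> Prop) -> Prop} {FF : Filter F}
  (f g : T -> C) (lf lg : C) :
  filterlim f F (locally (T := C_UniformSpace) lf) ->
  filterlim g F (locally (T := C_UniformSpace) lg) ->
  filterlim (fun t => (f t + g t)%C) F (locally (T := C_UniformSpace) (lf + lg)%C).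
Proof.
  intros Hf Hg; eapply filterlim_comp_2; [exact Hf | exact Hg|].
  apply (filterlim_plus (V := C_NormedModule)).
Qed.

Lemma filterlim_Cmult_l {T : Type} {F : (T -> Prop) -> Prop} {FF : Filter F}
  (c : C) (f : T -> C) (l : C) :
  filterlim f F (locally (T := C_UniformSpace) l) ->
  filterlim (fun t => (c * f t)%C) F (locally (T := C_UniformSpace) (c * l)%C).
Proof.
  intros Hf; eapply filterlim_comp; [exact Hf|].
  apply (filterlim_scal_r (V := C_NormedModule) c l).
Qed.

Lemma filterlim_RtoC_mult {T : Type} {F : (T -> Prop) -> Prop} {FF : Filter F}
  (u : T -> R) (l : R) (c : C) :
  filterlim u F (locally l) ->
  filterlim (fun t => (RtoC (u t) * c)%C) F (locally (T := C_UniformSpace) (RtoC l * c)%C).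
Proof.
  intros Hu; rewrite <- scal_R_Cmult.
  apply filterlim_ext with (fun t => scal (V := C_R_ModuleSpace) (u t) c).
  { intros t; apply scal_R_Cmult. }
  apply (filterlim_comp _ _ _ u (fun x => scal (V := C_R_ModuleSpace) x c) _ _ _ Hu).
  apply (filterlim_scal_l (V := C_R_NormedModule) l c).
Qed.

Lemma Csum_succ (f : nat -> C) (n : nat) : Csum f (S n) = (Csum f n + f n)%C.
Proof.
  destruct n as [|n]; simpl.
  - now rewrite sum_O, Cplus_0_l.
  - now rewrite sum_Sn.
Qed.

Lemma Csum_mult_l (c : C) (f : nat -> C) (n : nat) :
  (c * Csum f n)%C = Csum (fun k => c * f k)%C n.
Proof.
  induction n as [|n IH]; [apply Cmult_0_r|].
  rewrite !Csum_succ, <- IH; ring.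
Qed.

Lemma filterlim_Csum {T : Type} {F : (T -> Prop) -> Prop} {FF : Filter F}
  (f : T -> nat -> C) (g : nat -> C) (n : nat) :
  (forall k, filterlim (fun t => f t k) F (locally (T := C_UniformSpace) (g k))) ->
  filterlim (fun t => Csum (f t) n) F (locally (T := C_UniformSpace) (Csum g n)).
Proof.
  intros Hfg; induction n as [|n IH]; [apply filterlim_const|].
  rewrite Csum_succ.
  apply filterlim_ext with (fun t => (Csum (f t) n + f t n)%C).
  { intros t; now rewrite Csum_succ. }
  now apply filterlim_Cplus.
Qed.

(** * The three parts of the kernel *)

Lemma RtoC_neq_0 (x : R) : x <> 0 -> RtoC x <> RtoC 0.
Proof. intros Hx E; now apply Hx, RtoC_inj. Qed.

Lemma filterlim_polynomial_part (theta beta : R) (m : nat) (xi : C) :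
  -1 < beta ->
  filterlim (fun r => Csum (fun n =>
      RtoC (poch (theta * r ^ 2 + beta + 2) n / poch (beta + 1) n)
      * (xi / RtoC (r ^ 2)) ^ n)%C m)
    (Rbar_locally p_infty)
    (locally (T := C_UniformSpace)
      (Csum (fun n => (RtoC theta * xi) ^ n / RtoC (poch (beta + 1) n))%C m)).
Proof.
  intros Hb; apply filterlim_Csum; intros n.
  assert (Hp := poch_pos (beta + 1) n ltac:(lra)).
  apply filterlim_ext_loc with
    (fun r => RtoC (scaled_poch theta (beta + 2) n r) * (/ RtoC (poch (beta + 1) n) * xi ^ n))%C.
  - exists 0; intros r Hr; unfold scaled_poch.
    assert (Hr2 : RtoC (r ^ 2) <> RtoC 0) by (apply RtoC_neq_0, pow_nonzero; lra).
    rewrite <- Rplus_assoc, !RtoC_div, (RtoC_pow (r ^ 2)) by (try apply pow_nonzero, pow_nonzero; lra).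
    unfold Cdiv; rewrite Cpow_mult_l, Cpow_inv by assumption; ring.
  - replace ((RtoC theta * xi) ^ n / RtoC (poch (beta + 1) n))%C
      with (RtoC (theta ^ n) * (/ RtoC (poch (beta + 1) n) * xi ^ n))%C.
    + apply filterlim_RtoC_mult, is_lim_scaled_poch.
    + rewrite RtoC_pow, Cpow_mult_l; unfold Cdiv; ring.
Qed.

(** The part of the hypergeometric coefficient that does not involve the
    parameter going to infinity. *)
Definition hyper_coeff (m : nat) (beta : R) (n : nat) : R :=
  poch 1 n ^ 3 / (poch (INR m + 1) n ^ 2 * poch (beta + 1) n * INR (fact n)).

(** Since [n! = (1)_n <= (m + 1)_n], only [1 / (beta + 1)_n] survives. *)
Lemma hyper_coeff_bounds (m : nat) (beta : R) (n : nat) : -1 < beta ->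
  0 < hyper_coeff m beta n <= / poch (beta + 1) n.
Proof.
  intros Hb; unfold hyper_coeff; rewrite <- poch_1.
  assert (Hm := pos_INR m).
  assert (H1 := poch_pos 1 n Rlt_0_1).
  assert (H2 := poch_le 1 (INR m + 1) n ltac:(lra)).
  assert (H3 := poch_pos (beta + 1) n ltac:(lra)).
  set (a := poch 1 n) in *; set (c := poch (INR m + 1) n) in *.
  set (d := poch (beta + 1) n) in *.
  replace (a ^ 3 / (c ^ 2 * d * a)) with ((a / c) * (a / c) * / d) by (field; lra).
  assert (0 < a / c <= 1).
  { split; [apply Rdiv_lt_0_compat; lra|].
    apply Rmult_le_reg_r with c; [lra|]; unfold Rdiv; rewrite Rmult_assoc, Rinv_l; lra. }
  assert (0 < / d) by now apply Rinv_0_lt_compat.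
  set (e := a / c) in *.
  split; [apply Rmult_lt_0_compat; nra|].
  rewrite <- (Rmult_1_l (/ d)) at 2; apply Rmult_le_compat_r; nra.
Qed.

(** Domination is needed for all values of the variable, but holds only for
    [r >= r0]. Replacing [r] by [Rmax r0 r] does not change the limit at infinity
    and makes the bound global. *)
Lemma filterlim_hypergeometric (theta beta : R) (m : nat) (xi : C) :
  0 < theta -> -1 < beta -> xi <> RtoC 0 ->
  filterlim (fun r => hypergeometric
      (1 :: 1 :: 1 :: theta * r ^ 2 + beta + 2 :: nil)
      (INR m + 1 :: INR m + 1 :: beta + 1 :: nil) (xi / RtoC (r ^ 2))%C)
    (Rbar_locally p_infty)
    (locally (T := C_UniformSpace) (hypergeometric (1 :: 1 :: 1 :: nil)
      (INR m + 1 :: INR m + 1 :: beta + 1 :: nil) (RtoC theta * xi)%C)).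
Proof.
  intros Ht Hb Hxi.
  assert (Hx : 0 < Cmod xi) by now apply Cmod_gt_0.
  (* Any positive [r0] with [|xi| < r0^2] would do. *)
  set (r0 := 1 + Cmod xi).
  assert (Hr0 : 0 < Cmod xi < r0 ^ 2) by (unfold r0; nra).
  set (q := scaled_poch theta (beta + 2)).
  set (w := hyper_coeff m beta).
  assert (Hpochs : forall n, poch (INR m + 1) n <> 0 /\ poch (beta + 1) n <> 0
                     /\ INR (fact n) <> 0).
  { intros n; assert (Hm := pos_INR m); repeat split.
    - apply Rgt_not_eq, poch_pos; lra.
    - apply Rgt_not_eq, poch_pos; lra.
    - apply INR_fact_neq_0. }
  apply filterlim_ext_loc with
    (fun r => CSeries (fun n => RtoC (q n (Rmax r0 r)) * (RtoC (w n) * xi ^ n))%C).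
  - exists r0; intros r Hr; rewrite Rmax_right by lra.
    unfold hypergeometric; f_equal; apply functional_extensionality; intros n.
    destruct (Hpochs n) as (P1 & P2 & P3).
    assert (Hr2 : r ^ 2 <> 0) by (apply pow_nonzero; unfold r0 in Hr; lra).
    unfold poch_prod, q, scaled_poch, w, hyper_coeff; cbn [List.map List.fold_right].
    unfold Cdiv; rewrite Cpow_mult_l, Cpow_inv by now apply RtoC_neq_0.
    rewrite <- RtoC_pow, <- !RtoC_inv by (try apply pow_nonzero; assumption).
    rewrite (Cmult_comm (xi ^ n)%C), <- (Cmult_assoc _ (xi ^ n)%C).
    rewrite (Cmult_comm (xi ^ n)%C), !Cmult_assoc, <- !RtoC_mult.
    f_equal; f_equal; rewrite <- Rplus_assoc. field.
    repeat split; try assumption; now apply pow_nonzero.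
  - unfold hypergeometric.
    replace (fun n => (RtoC (poch_prod (1 :: 1 :: 1 :: nil) n
        / poch_prod (INR m + 1 :: INR m + 1 :: beta + 1 :: nil) n)%R
        * ((RtoC theta * xi) ^ n / RtoC (INR (fact n))))%C)
      with (fun n => (RtoC (theta ^ n) * (RtoC (w n) * xi ^ n))%C).
    2: { apply functional_extensionality; intros n.
      destruct (Hpochs n) as (P1 & P2 & P3).
      unfold poch_prod, w, hyper_coeff; cbn [List.map List.fold_right]; unfold Cdiv.
      rewrite Cpow_mult_l, <- RtoC_pow, <- RtoC_inv by assumption.
      rewrite <- (Cmult_assoc (RtoC (theta ^ n))), (Cmult_comm (xi ^ n)%C).
      rewrite !Cmult_assoc, <- !RtoC_mult; f_equal; f_equal; field; tauto. }
    apply filterlim_CSeries_dominated with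
      (fun n => q n r0 / poch (beta + 1) n * Cmod xi ^ n).
    + apply ex_series_scaled_poch_ratio; try lra; unfold r0; lra.
    + intros r n; rewrite !Cmod_mult, !Cmod_R, Cmod_pow.
      destruct (hyper_coeff_bounds m beta n Hb) as [W1 W2]; fold w in W1, W2.
      assert (Q1 := Rmax_l r0 r).
      assert (Q2 : 0 < q n (Rmax r0 r)) by (apply scaled_poch_pos; unfold r0 in *; lra).
      assert (Q3 : q n (Rmax r0 r) <= q n r0)
        by (apply scaled_poch_antitone; unfold r0 in *; lra).
      rewrite !Rabs_pos_eq by lra.
      rewrite <- Rmult_assoc; apply Rmult_le_compat_r; [apply pow_le; lra|].
      apply Rmult_le_compat; lra.
    + intros n; apply filterlim_RtoC_mult.
      apply filterlim_ext_loc with (q n); [| apply is_lim_scaled_poch].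
      exists r0; intros r Hr; now rewrite Rmax_right by lra.
Qed.

(** With [s = theta r^2 + beta + 1 - m - k] and [j = m + k + 1] the only part that
    varies is [r^(2j) Gamma s / Gamma (s + j) = r^(2j) / (s)_j], whose limit is
    [1 / theta^j]. *)
Lemma filterlim_A_term (theta beta : R) (p m : nat) (xi : C) :
  0 < theta -> xi <> RtoC 0 ->
  filterlim (fun r => A_term (theta * r ^ 2) beta p m r xi)
    (Rbar_locally p_infty)
    (locally (T := C_UniformSpace) (B_term theta beta p m xi)).
Proof.
  intros Ht Hxi; unfold A_term, B_term.
  destruct (p <=? m)%nat; [apply filterlim_const|].
  rewrite Csum_mult_l; eapply filterlim_ext; [intros r; symmetry; apply Csum_mult_l|].
  apply filterlim_Csum; intros k.
  set (c := beta + 1 - INR m - INR k).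
  set (j := (m + k + 1)%nat).
  set (d := (INR (fact k) / INR (fact (m + k))) ^ 2
             * (Gamma (beta + 1) / Gamma (beta - INR m - INR k))).
  assert (Hth : theta ^ j <> 0) by (apply pow_nonzero; lra).
  assert (HQ : filterlim (fun r => d * / scaled_poch theta c j r)
                 (Rbar_locally p_infty) (locally (d * / theta ^ j))).
  { apply (is_lim_scal_l _ d p_infty (Finite _)).
    apply (is_lim_inv _ p_infty (Finite _)); [apply is_lim_scaled_poch|].
    intros E; now injection E. }
  apply (filterlim_RtoC_mult _ _ ((/ xi) ^ (k + 1))%C) in HQ.
  replace (RtoC (1 / theta ^ m) * (RtoC d * (1 / (RtoC theta * xi) ^ (k + 1))))%C
    with (RtoC (d * / theta ^ j) * (/ xi) ^ (k + 1))%C.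
  - eapply filterlim_ext_loc; [| exact HQ].
    (* For [r > 1] one has [theta r^2 + c >= theta r + c], so the second bound
       forces the argument of Gamma beyond 1. *)
    exists (Rmax 1 ((1 - c + 1) / theta)); intros r Hr.
    assert (Hr1 := Rle_lt_trans _ _ _ (Rmax_l _ _) Hr).
    assert (Hr2 := Rle_lt_trans _ _ _ (Rmax_r _ _) Hr).
    set (s := theta * r ^ 2 + c).
    assert (Hs : 1 < s).
    { apply Rmult_lt_compat_l with (r := theta) in Hr2; [|assumption].
      replace (theta * ((1 - c + 1) / theta)) with (1 - c + 1) in Hr2 by (field; lra).
      assert (theta * r <= theta * r ^ 2) by (apply Rmult_le_compat_l; nra).
      unfold s; lra. }
    destruct (is_RInt_gen_Gamma s Hs) as [HGs _].
    assert (Hps := poch_pos s j ltac:(lra)).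
    replace (theta * r ^ 2 + beta + 1 - INR m - INR k) with s by (unfold s, c; ring).
    replace (theta * r ^ 2 + beta + 2) with (s + INR j)
      by (unfold s, c, j; rewrite !plus_INR; simpl; ring).
    rewrite Gamma_add_nat by assumption.
    assert (Hr0 : r ^ 2 <> 0) by (apply pow_nonzero; lra).
    unfold Cdiv; rewrite Cpow_mult_l, <- RtoC_pow, !Cmult_assoc, <- !RtoC_mult.
    f_equal; f_equal; unfold scaled_poch; fold s.
    replace ((r ^ 2) ^ j) with (r ^ (2 * m) * (r ^ 2) ^ (k + 1)).
    + (* The denominator Gamma (beta - m - k) is the same on both sides, so
         its inverse can be treated as an arbitrary number. *)
      unfold d, Rdiv; generalize (/ Gamma (beta - INR m - INR k)); intros y.
      field.
      repeat split; try apply INR_fact_neq_0; try apply pow_nonzero; lra.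
    + rewrite pow_mult, <- pow_add; f_equal; unfold j; lia.
  - rewrite Cpow_inv by assumption; unfold Cdiv.
    assert (RtoC theta <> RtoC 0) by (apply RtoC_neq_0; lra).
    rewrite Cpow_mult_l, Rdiv_1_l, RtoC_mult, !RtoC_inv, !RtoC_pow
      by (try apply pow_nonzero; lra).
    replace j with (m + (k + 1))%nat by (unfold j; lia).
    rewrite Cpow_add_r; field; repeat split; now apply Cpow_nz.
Qed.

Theorem corollary1 (theta beta0 beta : R) (m p : nat) (xi : C)
  (htheta : 0 < theta) (hbeta0 : -1 < beta0 <= 0) (hbeta : beta = beta0 + INR p)
  (hxi : xi <> RtoC 0) :
  filterlim (fun r : R => K_bergman (theta * r ^ 2) beta p m r xi)
    (Rbar_locally p_infty)
    (locally (T := C_UniformSpace) (L_bargmann theta beta p m xi)).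
Proof.
  assert (Hb : -1 < beta) by (assert (H := pos_INR p); lra).
  unfold K_bergman, L_bargmann.
  apply filterlim_Cplus; [apply filterlim_Cplus|].
  - now apply filterlim_polynomial_part.
  - now apply filterlim_Cmult_l, filterlim_hypergeometric.
  - now apply filterlim_A_term.
Qed.
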